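(* Let $X$ be an Hadamard space, $T$ a metrically nonspreading mapping of $X$ into itself, $\{\alpha_n\}$ a sequence in $(0,1]$ such that $\sum_{n=1}^{\infty}\alpha_n=\infty$, and $\{x_n\}$ a sequence defined by $x_1\in X$ and \[ x_{n+1}=(1-\alpha_n)x_n\oplus\alpha_n Tx_n \] for all $n\in\mathbb{N}$. Then the following hold. (i) $\mathcal{F}(T)$ is nonempty if and only if $\{x_n\}$ is bounded; (ii) if $\mathcal{F}(T)$ is nonempty and $\inf_n\alpha_n(1-\alpha_n)>0$, then $\{x_n\}$ is $\Delta$-convergent to an element of $\mathcal{F}(T)$.
   Context: $\mathbb{N}$ is the set of positive integers. $\mathcal{F}(T)=\{u\in X : Tu=u\}$ denotes the set of all fixed points of $T$. A mapping $T$ of a metric space $(X,d)$ into itself is metrically nonspreading if $2d(Tx,Ty)^2 \leq d(Tx,y)^2 + d(Ty,x)^2$ for all $x,y\in X$. The asymptotic center of a sequence $\{x_n\}$ in $X$ is $\mathcal{A}(\{x_n\})=\{u\in X : \limsup_n d(u,x_n)=\inf_{y\in X}\limsup_n d(y,x_n)\}$, where upper limits are taken in $[0,\infty]$. The sequence $\{x_n\}$ is $\Delta$-convergent to $p\in X$ if $\mathcal{A}(\{x_{n_i}\})=\{p\}$ for each subsequence $\{x_{n_i}\}$ of $\{x_n\}$. A metric space $X$ is uniquely geodesic if for all $x,y\in X$ there is a unique mapping $\gamma\colon[0,l]\to X$, $l=d(x,y)$, with $\gamma(0)=x$, $\gamma(l)=y$ and $d(\gamma(s),\gamma(t))=|s-t|$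 for all $s,t\in[0,l]$; the point $\gamma(\alpha l)$ is denoted by $(1-\alpha)x\oplus\alpha y$ for $\alpha\in[0,1]$. A $\mathrm{CAT}(0)$ space is a uniquely geodesic metric space such that $d((1-\alpha)x\oplus\alpha y,(1-\beta)x\oplus\beta z)\leq |(1-\alpha)\bar x+\alpha\bar y-((1-\beta)\bar x+\beta\bar z)|_{\mathbb{R}^2}$ whenever $x,y,z\in X$, $\alpha,\beta\in[0,1]$ and $\bar x,\bar y,\bar z\in\mathbb{R}^2$ satisfy $d(x,y)=|\bar x-\bar y|_{\mathbb{R}^2}$, $d(y,z)=|\bar y-\bar z|_{\mathbb{R}^2}$, $d(z,x)=|\bar z-\bar x|_{\mathbb{R}^2}$, where $|\cdot|_{\mathbb{R}^2}$ is the Euclidean norm. An Hadamard space is a complete $\mathrm{CAT}(0)$ space. *)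

(* Defs.v *)
From HB Require Import structures.
From mathcomp Require Import all_boot all_order all_algebra.
From mathcomp Require Import all_classical all_reals all_analysis.
Set Implicit Arguments.
Unset Strict Implicit.
Unset Printing Implicit Defensive.
Import Order.TTheory GRing.Theory Num.Theory.

Local Open Scope classical_set_scope.
Local Open Scope ring_scope.

(* As always for [Complete], the carrier is pointed, hence nonempty. *)
#[short(type="completeMetricType")]
HB.structure Definition CompleteMetric (K : numFieldType) :=
  {T of Metric K T & Complete T}.

Definition fixed_points (X : Type) (T : X -> X) : set X := [set u | T u = u].

Definition metrically_nonspreading (R : realType) (X : metricType R)
    (T : X -> X) : Prop :=
  forall x y : X,
    2 * mdist (T x) (T y) ^+ 2 <= mdist (T x) y ^+ 2 + mdist (T y) x ^+ 2.

Definition metric_bounded (R : realType) (X : metricType R) (A : set X) : Prop :=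
  exists M : R, forall u v : X, A u -> A v -> mdist u v <= M.

Definition limsup_dist (R : realType) (X : metricType R) (x : nat -> X)
    (u : X) : \bar R :=
  limn_esup (fun n => (mdist u (x n))%:E).

Definition asymptotic_center (R : realType) (X : metricType R)
    (x : nat -> X) : set X :=
  [set u | limsup_dist x u = ereal_inf (range (limsup_dist x))].

Definition Delta_convergent (R : realType) (X : metricType R)
    (x : nat -> X) (p : X) : Prop :=
  forall f : nat -> nat, {homo f : m n / (m < n)%N} ->
    asymptotic_center (x \o f) = [set p].

(* A mapping [0, d(x, y)] -> X is represented by a total map R -> X, of which
   only the values on [0, d(x, y)] are relevant. *)
Definition is_geodesic (R : realType) (X : metricType R) (x y : X)
    (g : R -> X) : Prop :=
  [/\ g 0 = x, g (mdist x y) = y &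
    forall s t : R, 0 <= s <= mdist x y -> 0 <= t <= mdist x y ->
      mdist (g s) (g t) = `|s - t|].

Definition uniquely_geodesic (R : realType) (X : metricType R) : Prop :=
  forall x y : X, exists2 g : R -> X, is_geodesic x y g &
    forall g' : R -> X, is_geodesic x y g' ->
      forall t : R, 0 <= t <= mdist x y -> g' t = g t.

(* [geo_comb a x y] is the point (1 - a) x (+) a y, for a in [0, 1]. The
   geodesic is selected by choice; in a uniquely geodesic space the point does
   not depend on that selection. The default value [fun=> x] is only used when
   no geodesic from x to y exists. *)
Definition geo_comb (R : realType) (X : metricType R) (a : R) (x y : X) : X :=
  xget (fun=> x) [set g : R -> X | is_geodesic x y g] (a * mdist x y).

(* The library norm on row vectors is the sup norm, hence this definition. *)
Definition euclidean_norm (R : realType) (v : 'rV[R]_2) : R :=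
  Num.sqrt (\sum_(i < 2) v 0 i ^+ 2).

Definition CAT0 (R : realType) (X : metricType R) : Prop :=
  uniquely_geodesic X /\
  forall (x y z : X) (a b : R) (x' y' z' : 'rV[R]_2),
    0 <= a <= 1 -> 0 <= b <= 1 ->
    mdist x y = euclidean_norm (x' - y') ->
    mdist y z = euclidean_norm (y' - z') ->
    mdist z x = euclidean_norm (z' - x') ->
    mdist (geo_comb a x y) (geo_comb b x z) <=
    euclidean_norm (((1 - a) *: x' + a *: y') - ((1 - b) *: x' + b *: z')).

(* Main.v *)
Require Import Defs.
From HB Require Import structures.
From mathcomp Require Import all_boot all_order all_algebra.
From mathcomp Require Import all_classical all_reals all_analysis.
From mathcomp Require Import lra.
Set Implicit Arguments.
Unset Strict Implicit.
Unset Printing Implicit Defensive.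
Import Order.TTheory GRing.Theory Num.Theory.
Import numFieldNormedType.Exports.

Local Open Scope classical_set_scope.
Local Open Scope ring_scope.

(** Both halves of the theorem come from minimizing, over the space, an upper
    limit of nonnegative functions built from squared distances. The CAT(0)
    comparison makes y |-> d(y, w)^2 strongly convex with a constant that does
    not depend on w ([CAT0_dist_geo_comb], [CAT0_midpoint]), and this survives
    weighted means and upper limits. For a strongly convex function the sets
    of near-minimizers have diameters tending to 0, so by completeness they
    shrink to a single point p ([exists_well_posed_minimizer]). If moreover
    the function G satisfies G (T y) <= G y, then T maps near-minimizers to
    near-minimizers, and the nonspreading inequality applied to y and p, as y
    and T y tend to p, becomes 2 d(p, Tp)^2 <= d(p, Tp)^2; hence Tp = p
    ([nonspreading_fixes_minimizer]).

    (i) A fixed point bounds the orbit because the distances from the orbit to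
    it decrease. Conversely, when the orbit is bounded, take for G (y) the
    upper limit of the means of d(y, T x_k)^2 with weights alpha_k. Adding up
    the nonspreading and the CAT(0) inequalities along the orbit telescopes:
    replacing y by T y raises the n-th mean by at most a constant divided by
    alpha_0 + ... + alpha_n ([mean_image_le]), which tends to 0 as the series
    diverges. So G (T y) <= G y, and p is a fixed point.

    (ii) When alpha_n (1 - alpha_n) stays above c > 0, the decrease of the
    squared distances to a fixed point forces d(x_n, T x_n) to 0
    ([mann_almost_fixed]). For any bounded sequence z with this property,
    G (y) = limsup d(y, z_n)^2 satisfies G (T y) <= G y, so the asymptotic
    center of z is a single point, which is fixed
    ([asymptotic_center_almost_fixed]). This applies to x and to each of its
    subsequences. The distances from x_n to a fixed point converge, so the
    upper limits along x and along a subsequence agree at both centers, and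
    the two centers coincide. *)

(** * The CAT(0) inequality *)

Section CAT0_inequality.
Variables (R : realType) (X : metricType R).
Hypothesis X_CAT0 : CAT0 X.
Implicit Types (x y z : X) (a : R).

Lemma geo_comb1 x y : geo_comb 1 x y = y.
Proof.
have [g gP _] := X_CAT0.1 x y.
rewrite /geo_comb mul1r.
by case: xgetP => [h _ [_ ->]|/(_ g)].
Qed.

Lemma geo_combxx a x : geo_comb a x x = x.
Proof.
have [g gP _] := X_CAT0.1 x x.
rewrite /geo_comb mdistxx mulr0.
by case: xgetP => [h _ [->]|/(_ g)].
Qed.

Lemma euclidean_normE (v : 'rV[R]_2) :
  euclidean_norm v = Num.sqrt (v 0 0 ^+ 2 + v 0 1 ^+ 2).
Proof.
rewrite /euclidean_norm !big_ord_recl big_ord0 addr0.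
by congr (Num.sqrt (_ + v 0 _ ^+ 2)); apply: val_inj.
Qed.

(** View z as the end point of the geodesic from x to z, so that the comparison
    applies; in the Euclidean plane the bound is Stewart's identity. *)
Lemma CAT0_dist_geo_comb a x y z : 0 <= a <= 1 ->
  mdist (geo_comb a x y) z ^+ 2 <=
  (1 - a) * mdist x z ^+ 2 + a * mdist y z ^+ 2 - a * (1 - a) * mdist x y ^+ 2.
Proof.
move=> a01; have [<-|xNy] := eqVneq x y.
  rewrite geo_combxx mdistxx expr0n mulr0 subr0 -mulrDl subrK mul1r.
  exact: lexx.
have : 0 < mdist x y by rewrite mdist_gt0.
have := metric_triangle x z y; have := metric_triangle y x z.
have := metric_triangle x y z; rewrite (metric_sym z y) (metric_sym y x).
have := X_CAT0.2 x y z a 1; rewrite geo_comb1 (metric_sym z x).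
have := mdist_ge0 x z; have := mdist_ge0 y z.
have := mdist_ge0 (geo_comb a x y) z.
move: (mdist _ z) (mdist y z) (mdist x z) (mdist x y).
move=> D A B C D0 A0 B0 cat tB tA tC C0.
(* The comparison triangle has vertices (0, 0), (C, 0) and (s, t). *)
pose s := (B ^+ 2 + C ^+ 2 - A ^+ 2) / (2 * C).
have sC : 2 * C * s = B ^+ 2 + C ^+ 2 - A ^+ 2.
  by rewrite /s mulrCA mulfV ?mulr1// mulf_neq0// gt_eqF.
have Bs : - B <= s by rewrite -(@ler_pM2l _ (2 * C)) ?mulr_gt0// sC; nra.
have sB : s <= B by rewrite -(@ler_pM2l _ (2 * C)) ?mulr_gt0// sC; nra.
pose t := Num.sqrt (B ^+ 2 - s ^+ 2).
have tE : t ^+ 2 = B ^+ 2 - s ^+ 2 by rewrite sqr_sqrtr//; nra.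
pose vec u v : 'rV[R]_2 := \row_j (if j == 0 then u else v).
have {}cat := cat (vec 0 0) (vec C 0) (vec s t) a01.
have := cat (introT andP (conj ler01 (lexx 1))).
rewrite !euclidean_normE !mxE /=.
rewrite subrr sub0r !expr0n addr0 sqrrN sub0r sqrrN !subr0 tE.
have -> : (C - s) ^+ 2 + (B ^+ 2 - s ^+ 2) = A ^+ 2 by nra.
rewrite (addrC (s ^+ 2)) subrK !sqrtr_sqr !ger0_norm ?(ltW C0)//.
move=> /(_ erefl erefl erefl).
set q := (X in Num.sqrt X) => Dq.
have q0 : 0 <= q by rewrite addr_ge0 ?sqr_ge0.
suff <- : q = (1 - a) * B ^+ 2 + a * A ^+ 2 - a * (1 - a) * C ^+ 2.
  by rewrite -(sqr_sqrtr q0) ler_sqr ?nnegrE ?sqrtr_ge0.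
rewrite /q; nra.
Qed.

End CAT0_inequality.

(** The point m serves all w at once: this uniformity is what allows the
    inequality to pass to weighted means and to upper limits. *)
Lemma CAT0_midpoint (R : realType) (X : metricType R) (X_CAT0 : CAT0 X)
    (y z : X) : exists m, forall w : X,
  mdist m w ^+ 2 <=
  (mdist y w ^+ 2 + mdist z w ^+ 2) / 2 - mdist y z ^+ 2 / 4.
Proof.
exists (geo_comb (1 / 2) y z) => w.
have half01 : 0 <= (1 / 2 : R) <= 1 by apply/andP; split; lra.
by have := CAT0_dist_geo_comb X_CAT0 y z w half01; lra.
Qed.

(** * Upper limits of bounded real sequences *)

Section real_limsup.
Variable R : realType.
Implicit Types (u v : nat -> R) (c : R).

Lemma limn_esup_le (u : nat -> \bar R) (c : \bar R) :
  (\forall n \near \oo, (u n <= c)%E) -> (limn_esup u <= c)%E.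
Proof.
move=> uc; rewrite /limn_esup limf_esupE; apply: ge_ereal_inf.
exists (ereal_sup [set u n | n in [set n | (u n <= c)%E]]).
  by exists [set n | (u n <= c)%E].
by apply: ge_ereal_sup => _ [n ? <-].
Qed.

Lemma limn_esup_lt (u : nat -> \bar R) (c : \bar R) :
  (limn_esup u < c)%E -> \forall n \near \oo, (u n < c)%E.
Proof.
rewrite /limn_esup limf_esupE => /ereal_inf_lt [_ [A Aoo <-] Ac].
apply: filterS Aoo => n An; apply: le_lt_trans Ac.
by apply: ereal_sup_ubound; exists n.
Qed.

(** Only used on sequences that are [bounded_nneg], so that [fine] never meets
    an infinite value. *)
Definition rlimsup u : R := fine (limn_esup (EFin \o u)).

Definition bounded_nneg u := exists c, forall n, 0 <= u n <= c.

Lemma rlimsup_fin u : bounded_nneg u -> limn_esup (EFin \o u) = (rlimsup u)%:E.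
Proof.
move=> [c uc]; rewrite fineK// fin_numElt; apply/andP; split.
  apply: (@lt_le_trans _ _ 0%E); first exact: ltNyr.
  apply: limf_esup_ge0; last by move=> n; rewrite lee_fin; case/andP: (uc n).
  exact: filter_not_empty.
apply: (@le_lt_trans _ _ c%:E); last exact: ltry.
by apply: limn_esup_le; apply: nearW => n; rewrite lee_fin; case/andP: (uc n).
Qed.

Lemma rlimsup_le u c : bounded_nneg u ->
  (\forall n \near \oo, u n <= c) -> rlimsup u <= c.
Proof.
move=> ub uc; rewrite -lee_fin -rlimsup_fin//; apply: limn_esup_le.
by apply: filterS uc => n; rewrite lee_fin.
Qed.

Lemma rlimsup_lt u c : bounded_nneg u -> rlimsup u < c ->
  \forall n \near \oo, u n < c.
Proof.
move=> ub; rewrite -lte_fin -rlimsup_fin// => /limn_esup_lt.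
by apply: filterS => n; rewrite lte_fin.
Qed.

Lemma rlimsup_ge0 u : bounded_nneg u -> 0 <= rlimsup u.
Proof.
move=> ub; rewrite -lee_fin -rlimsup_fin//; apply: limf_esup_ge0.
  exact: filter_not_empty.
by case: ub => c uc n; rewrite lee_fin; case/andP: (uc n).
Qed.

(** An error term that tends to 0 is invisible to upper limits. *)
Lemma rlimsup_le_eps u v : bounded_nneg u -> bounded_nneg v ->
  (forall e, 0 < e -> \forall n \near \oo, u n <= v n + e) ->
  rlimsup u <= rlimsup v.
Proof.
move=> ub vb uv; apply/ler_addgt0Pr => e e0; apply: rlimsup_le => //.
have e20 : 0 < e / 2 by rewrite divr_gt0.
have vlt : rlimsup v < rlimsup v + e / 2 by rewrite ltrDl.
near=> n.
have : u n <= v n + e / 2 by near: n; exact: uv.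
have : v n < rlimsup v + e / 2 by near: n; exact: rlimsup_lt.
lra.
Unshelve. all: by end_near. Qed.

Lemma bounded_nneg_sqr u : bounded_nneg u -> bounded_nneg (fun n => u n ^+ 2).
Proof.
move=> [c uc]; exists (c ^+ 2) => n; rewrite sqr_ge0/=.
by have := uc n; nra.
Qed.

Lemma rlimsup_sqr u : bounded_nneg u ->
  rlimsup (fun n => u n ^+ 2) = rlimsup u ^+ 2.
Proof.
move=> ub; have ub2 := bounded_nneg_sqr ub; have [c uc] := ub.
have r0 := rlimsup_ge0 ub; have s0 := rlimsup_ge0 ub2.
apply/eqP; rewrite eq_le; apply/andP; split.
  rewrite -[leLHS]sqr_sqrtr// ler_sqr ?nnegrE ?sqrtr_ge0//.
  apply/ler_addgt0Pr => e e0; have re0 : 0 <= rlimsup u + e by lra.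
  rewrite -[leRHS](ger0_norm re0) -sqrtr_sqr ler_sqrt ?sqr_ge0//.
  apply: rlimsup_le => //.
  have : rlimsup u < rlimsup u + e by rewrite ltrDl.
  move=> /(rlimsup_lt ub); apply: filterS => n un.
  by rewrite ler_sqr ?nnegrE ?(ltW un)//; case/andP: (uc n).
apply/ler_addgt0Pr => e e0.
have se0 : 0 <= rlimsup (fun n => u n ^+ 2) + e by lra.
rewrite -[leRHS]sqr_sqrtr// ler_sqr ?nnegrE ?sqrtr_ge0//.
apply: rlimsup_le => //.
have : rlimsup (fun n => u n ^+ 2) < rlimsup (fun n => u n ^+ 2) + e.
  by rewrite ltrDl.
move=> /(rlimsup_lt ub2); apply: filterS => n un.
have /andP[un0 _] := uc n.
by rewrite -[leLHS](ger0_norm un0) -sqrtr_sqr ler_sqrt// ltW.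
Qed.

End real_limsup.

(** * Minimizers of strongly convex functions *)

Section minimizers.
Variables (R : realType) (X : completeMetricType R).
Implicit Types (G : X -> R) (p y z : X).

Definition midpoint_strongly_convex G :=
  forall y z, exists m, G m <= (G y + G z) / 2 - mdist y z ^+ 2 / 4.

(** Tykhonov well-posedness: every minimizing sequence of G converges to p.
    Without continuity of G, this does not say that G attains its infimum
    at p. *)
Definition well_posed_minimizer G p :=
  forall e, 0 < e -> exists2 d, 0 < d &
    forall y, G y < inf (range G) + d -> mdist p y < e.

Lemma near_minimizer G d : (forall y, 0 <= G y) -> 0 < d ->
  exists y, G y < inf (range G) + d.
Proof.
move=> G0 d0; have [|_ [y _ <-] Gy] := @inf_adherent _ (range G) d d0.
  by split; [exists (G point), point|exists 0 => _ [y _ <-]].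
by exists y.
Qed.

Lemma inf_range_le G y : (forall y, 0 <= G y) -> inf (range G) <= G y.
Proof. by move=> G0; apply: ge_inf; [exists 0 => _ [z _ <-]|exists y]. Qed.

(** If y and z are within d of the infimum, strong convexity and the fact that
    G is at least its infimum at their midpoint give d(y, z)^2 < 4 d. The
    sublevel sets therefore generate a Cauchy filter, whose limit is p. *)
Lemma exists_well_posed_minimizer G : (forall y, 0 <= G y) ->
  midpoint_strongly_convex G -> exists p, well_posed_minimizer G p.
Proof.
move=> G0 Gconv; pose I := inf (range G).
pose F : set_system X :=
  filter_from [set d : R | 0 < d] (fun d => [set y | G y < I + d]).
have FF : ProperFilter F.
  apply: filter_from_proper; last by move=> d; exact: near_minimizer.
  apply: filter_from_filter; first by exists 1 => /=.
  move=> d e /= d0 e0; exists (Num.min d e); first by rewrite /= lt_min d0.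
  by move=> y /=; rewrite addr_minr lt_min => /andP[].
have FC : cauchy F.
  apply: cauchy_exP => e e0.
  have d0 : 0 < e ^+ 2 / 4 by rewrite divr_gt0// exprn_gt0.
  have [z Gz] := near_minimizer G0 d0.
  exists z; exists (e ^+ 2 / 4) => // y /= Gy.
  rewrite ballEmdist /=.
  have [m Gm] := Gconv z y; have := inf_range_le m G0.
  rewrite -/I in Gz Gy * => Im.
  rewrite -ltr_sqr ?nnegrE ?mdist_ge0 ?(ltW e0)//; lra.
exists (lim F) => e e0.
have /(_ (ball (lim F) e) (nbhsx_ballx _ _ e0)) [d d0 dF] :=
  @cauchy_cvg X F FF FC.
by exists d => // y /dF; rewrite ballEmdist.
Qed.

(** For a near-minimizer y, both y and T y are close to p, and the nonspreading
    inequality for y and p would give 2 D^2 <= D^2 in the limit, where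
    D = d(p, Tp). *)
Lemma nonspreading_fixes_minimizer (T : X -> X) G p :
  metrically_nonspreading T -> (forall y, 0 <= G y) ->
  (forall y, G (T y) <= G y) -> well_posed_minimizer G p -> T p = p.
Proof.
move=> Tns G0 GT pP; apply/esym/eqP/negPn/negP; rewrite -mdist_gt0 => D0.
(* With y and T y within D / 8 of p, the inequality would read
   2 (7/8 D)^2 <= (1/8 D)^2 + (9/8 D)^2, that is 98 <= 82. *)
have e0 : 0 < mdist p (T p) / 8 by rewrite divr_gt0.
have [d d0 dP] := pP _ e0.
have [y Gy] := near_minimizer G0 d0.
have := dP _ Gy; have := dP _ (le_lt_trans (GT y) Gy).
have := Tns y p; have := metric_triangle p (T y) (T p).
have := metric_triangle (T p) p y.
rewrite (metric_sym (T p) p) (metric_sym (T y) p).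
have := mdist_ge0 p y; have := mdist_ge0 p (T y).
have := mdist_ge0 (T p) y; have := mdist_ge0 (T y) (T p).
move: (mdist p (T p)) D0 (mdist p y) (mdist p (T y)) (mdist (T p) y)
  (mdist (T y) (T p)) => D D0 a b c f *.
have f2 : (7 / 8 * D) ^+ 2 <= f ^+ 2 by rewrite ler_sqr ?nnegrE; lra.
have c2 : c ^+ 2 <= (9 / 8 * D) ^+ 2 by rewrite ler_sqr ?nnegrE; lra.
have b2 : b ^+ 2 <= (1 / 8 * D) ^+ 2 by rewrite ler_sqr ?nnegrE; lra.
have : 0 < D ^+ 2 by rewrite exprn_gt0.
nra.
Qed.

Lemma rlimsup_midpoint_strongly_convex (u : nat -> X -> R) :
  (forall y, bounded_nneg (u^~ y)) ->
  (forall y z, exists m, forall n,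
     u n m <= (u n y + u n z) / 2 - mdist y z ^+ 2 / 4) ->
  midpoint_strongly_convex (fun y => rlimsup (u^~ y)).
Proof.
move=> ub uconv y z; have [m um] := uconv y z; exists m.
apply/ler_addgt0Pr => e e0; apply: rlimsup_le => //.
have ylt : rlimsup (u^~ y) < rlimsup (u^~ y) + e by rewrite ltrDl.
have zlt : rlimsup (u^~ z) < rlimsup (u^~ z) + e by rewrite ltrDl.
near=> n; have := um n.
have : u n y < rlimsup (u^~ y) + e by near: n; exact: rlimsup_lt ylt.
have : u n z < rlimsup (u^~ z) + e by near: n; exact: rlimsup_lt zlt.
lra.
Unshelve. all: by end_near. Qed.

End minimizers.

(** * Metrically nonspreading mappings *)

Lemma increasing_cvg_nat (f : nat -> nat) :
  {homo f : m n / (m < n)%N} -> f @ \oo --> \oo.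
Proof.
move=> f_incr; apply/cvgnyPge => N; exists N => // n /= Nn.
apply: (leq_trans Nn).
by elim: n {Nn} => // n IH; apply: leq_ltn_trans IH (f_incr _ _ _).
Qed.

Section nonspreading.
Variables (R : realType) (X : completeMetricType R) (T : X -> X).
Hypotheses (X_CAT0 : CAT0 X) (Tns : metrically_nonspreading T).
Implicit Types (p y u : X) (z : nat -> X).

Lemma nonspreading_quasi_nonexpansive p y :
  T p = p -> mdist (T y) p <= mdist y p.
Proof.
move=> Tp; have := Tns y p; rewrite Tp (metric_sym p y) => H.
by rewrite -ler_sqr ?nnegrE ?mdist_ge0//; lra.
Qed.

Lemma metric_bounded_dist z u : metric_bounded (range z) ->
  bounded_nneg (fun n => mdist u (z n)).
Proof.
move=> [M zM]; exists (mdist u (z 0%N) + M) => n; rewrite mdist_ge0/=.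
apply: le_trans (metric_triangle _ (z 0%N) _) _.
by rewrite lerD2l; apply: zM; [exists 0%N|exists n].
Qed.

(** The nonspreading inequality between z_n and z_0 bounds 2 a^2, where
    a = d(T z_n, T z_0), by a^2 plus terms that are linear in a. *)
Lemma metric_bounded_image z :
  metric_bounded (range z) -> metric_bounded (range (T \o z)).
Proof.
move=> zb; have [M zM] := metric_bounded_dist (T (z 0%N)) zb.
pose D := mdist (T (z 0%N)) (z 0%N).
(* Completing the square gives (a - D)^2 <= 2 D^2 + M^2 <= (2 D + M)^2. *)
have K n : mdist (T (z n)) (T (z 0%N)) <= 3 * D + M.
  have := Tns (z n) (z 0%N); have /andP[] := zM n.
  have := metric_triangle (T (z n)) (T (z 0%N)) (z 0%N); rewrite -/D.
  have : 0 <= D by exact: mdist_ge0.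
  have := mdist_ge0 (T (z n)) (z 0%N).
  have := mdist_ge0 (T (z n)) (T (z 0%N)).
  move: D (mdist (T (z n)) (T (z 0%N))) (mdist (T (z n)) (z 0%N))
    (mdist (T (z 0%N)) (z n)) => d a b c a0 b0 d0 bad c0 cM ns.
  rewrite leNgt; apply/negP => lta.
  have : b ^+ 2 <= (a + d) ^+ 2 by rewrite ler_sqr ?nnegrE; lra.
  have : c ^+ 2 <= M ^+ 2 by rewrite ler_sqr ?nnegrE; lra.
  have : (2 * d + M) ^+ 2 < (a - d) ^+ 2 by rewrite ltr_sqr ?nnegrE; lra.
  nra.
exists (3 * D + M + (3 * D + M)) => _ _ [n _ <-] [k _ <-].
apply: le_trans (metric_triangle _ (T (z 0%N)) _) _.
by apply: lerD; last rewrite metric_sym; exact: K.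
Qed.

Definition asymptotic_radius z y := rlimsup (fun n => mdist y (z n)).

Lemma limsup_distE z y : metric_bounded (range z) ->
  limsup_dist z y = (asymptotic_radius z y)%:E.
Proof. by move=> zb; rewrite -rlimsup_fin//; exact: metric_bounded_dist. Qed.

Lemma asymptotic_centerP z p : metric_bounded (range z) ->
  asymptotic_center z p <->
  forall y, asymptotic_radius z p <= asymptotic_radius z y.
Proof.
move=> zb; split=> [pA y|pmin].
  rewrite -lee_fin -!limsup_distE// pA.
  by apply: ge_ereal_inf; exists (limsup_dist z y) => //; exists y.
apply/eqP; rewrite eq_le; apply/andP; split; last first.
  by apply: ge_ereal_inf; exists (limsup_dist z p) => //; exists p.
apply/ereal_infP => _ [y _ <-].
by rewrite !limsup_distE// lee_fin.
Qed.

Lemma asymptotic_radius_lipschitz z y u : metric_bounded (range z) ->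
  asymptotic_radius z y <= mdist y u + asymptotic_radius z u.
Proof.
move=> zb; have yb := metric_bounded_dist y zb.
have ub := metric_bounded_dist u zb.
apply/ler_addgt0Pr => e e0; apply: rlimsup_le => //.
have : asymptotic_radius z u < asymptotic_radius z u + e by rewrite ltrDl.
move=> /(rlimsup_lt ub); apply: filterS => n un.
by have := metric_triangle y u (z n); lra.
Qed.

(** The radius is 1-Lipschitz, so p, as a limit of near-minimizers, is a true
    minimizer; well-posedness excludes any other one. *)
Lemma asymptotic_center_well_posed z p : metric_bounded (range z) ->
  well_posed_minimizer (fun y => rlimsup (fun n => mdist y (z n) ^+ 2)) p ->
  asymptotic_center z = [set p].
Proof.
move=> zb; set G := (X in well_posed_minimizer X) => pP.
have db y := metric_bounded_dist y zb.
have rG y : G y = asymptotic_radius z y ^+ 2 by exact: rlimsup_sqr.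
have r0 y : 0 <= asymptotic_radius z y := rlimsup_ge0 (db y).
have G0 y : 0 <= G y by rewrite rG sqr_ge0.
have rle y w :
    (asymptotic_radius z y <= asymptotic_radius z w) = (G y <= G w).
  by rewrite !rG ler_sqr ?nnegrE.
apply/seteqP; split=> [q /(asymptotic_centerP _ zb) qmin|_ ->] /=.
  apply/esym/eqP/negPn/negP; rewrite -mdist_gt0 => pq.
  have [d d0 dP] := pP _ pq.
  suff : mdist p q < mdist p q by rewrite ltxx.
  apply: dP.
  have [y] := near_minimizer G0 d0.
  by apply: le_lt_trans; rewrite -rle.
apply/asymptotic_centerP => // w; rewrite leNgt; apply/negP => wp.
(* If w had a smaller radius than p, some near-minimizer y at most as large as
   w would be closer to p than the difference of the radii of p and w. *)
have [d d0 dP] := pP _ (etrans (subr_gt0 _ _) wp).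
have [y yd yw] : exists2 y, G y < inf (range G) + d & G y <= G w.
  have [wd|wd] := ltP (G w) (inf (range G) + d); first by exists w.
  have [y yd] := near_minimizer G0 d0.
  by exists y => //; apply: le_trans wd; exact: ltW.
have := dP y yd; have := asymptotic_radius_lipschitz p y zb.
by move: yw; rewrite -rle; lra.
Qed.

(** A demiclosedness principle. As d(z_n, T z_n) tends to 0, the nonspreading
    inequality for y and z_n becomes 2 d(Ty, z_n)^2 <= d(Ty, z_n)^2 +
    d(y, z_n)^2 up to a vanishing error, so the functional defining the
    asymptotic center does not increase under T. *)
Lemma asymptotic_center_almost_fixed z : metric_bounded (range z) ->
  (fun n => mdist (z n) (T (z n))) @ \oo --> 0 ->
  exists2 p, T p = p & asymptotic_center z = [set p].
Proof.
move=> zb dz0; have db y := metric_bounded_dist y zb.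
pose G y := rlimsup (fun n => mdist y (z n) ^+ 2).
have G0 y : 0 <= G y by apply: rlimsup_ge0; exact: bounded_nneg_sqr.
have [|p pP] := exists_well_posed_minimizer G0.
  apply: (rlimsup_midpoint_strongly_convex
            (u := fun n y => mdist y (z n) ^+ 2)) => [y|y w].
    exact: bounded_nneg_sqr.
  have [m mP] := CAT0_midpoint X_CAT0 y w.
  by exists m => n; exact: mP.
exists p; last exact: asymptotic_center_well_posed.
apply: nonspreading_fixes_minimizer (pP) => // y.
apply: rlimsup_le_eps; [exact: bounded_nneg_sqr|exact: bounded_nneg_sqr|].
move=> e e0; have [A yA] := db (T y); have [B yB] := db y.
(* With h = d(z_n, T z_n), the error is at most (4 A + 2 B) h; the summand 1
   only makes the denominator positive. *)
have AB0 : 0 < 4 * A + 2 * B + 1.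
  by have /andP[] := yA 0%N; have /andP[] := yB 0%N; lra.
have eAB : 0 < e / (4 * A + 2 * B + 1) by rewrite divr_gt0.
move/cvgr0Pnorm_lt : dz0 => /(_ _ eAB); apply: filterS => n.
rewrite ger0_norm ?mdist_ge0// ltr_pdivlMr//.
have := metric_triangle y (z n) (T (z n)).
have := metric_triangle (T y) (T (z n)) (z n).
have := Tns y (z n); have := yA n; have := yB n.
rewrite (metric_sym (T (z n)) y) (metric_sym (T (z n)) (z n)).
have := mdist_ge0 (z n) (T (z n)).
have := mdist_ge0 y (T (z n)).
have := mdist_ge0 (T y) (T (z n)).
move: (mdist (T y) (T (z n))) (mdist y (T (z n))) (mdist (z n) (T (z n)))
  (mdist (T y) (z n)) (mdist y (z n)) => f g h a b f0 g0 h0.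
move=> /andP[b0 bB] /andP[a0 aA] ns taf tgb he.
have hA : h * a <= h * A by rewrite ler_wpM2l.
have hB : h * b <= h * B by rewrite ler_wpM2l.
have hb0 : 0 <= h * b by rewrite mulr_ge0.
have ha0 : 0 <= h * a by rewrite mulr_ge0.
have g2 : g ^+ 2 <= (b + h) ^+ 2 by rewrite ler_sqr ?nnegrE; lra.
have [ah|ha] := leP a h; first by nra.
have f2 : (a - h) ^+ 2 <= f ^+ 2 by rewrite ler_sqr ?nnegrE; lra.
nra.
Qed.

End nonspreading.

(** * The Mann iteration *)

Section mann_iteration.
Variables (R : realType) (X : completeMetricType R) (T : X -> X).
Variables (alpha : nat -> R) (x : nat -> X).
Hypotheses (X_CAT0 : CAT0 X) (Tns : metrically_nonspreading T).
Hypothesis alpha_in : forall n, 0 < alpha n <= 1.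
Hypothesis x_rec : forall n, x n.+1 = geo_comb (alpha n) (x n) (T (x n)).

Lemma mann_dist_sqr y n : mdist (x n.+1) y ^+ 2 <=
  (1 - alpha n) * mdist (x n) y ^+ 2 + alpha n * mdist (T (x n)) y ^+ 2
    - alpha n * (1 - alpha n) * mdist (x n) (T (x n)) ^+ 2.
Proof.
rewrite x_rec; apply: CAT0_dist_geo_comb => //.
by have /andP[/ltW -> ->] := alpha_in n.
Qed.

Lemma mann_fixed_decrease p n : T p = p -> mdist (x n.+1) p ^+ 2 <=
  mdist (x n) p ^+ 2
    - alpha n * (1 - alpha n) * mdist (x n) (T (x n)) ^+ 2.
Proof.
move=> Tp; apply: le_trans (mann_dist_sqr p n) _.
have /andP[a0 a1] := alpha_in n.
have : mdist (T (x n)) p ^+ 2 <= mdist (x n) p ^+ 2.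
  rewrite ler_sqr ?nnegrE ?mdist_ge0//.
  exact: nonspreading_quasi_nonexpansive.
nra.
Qed.

Lemma mann_fejer p : T p = p -> nonincreasing_seq (fun n => mdist p (x n)).
Proof.
move=> Tp; apply/nonincreasing_seqP => n; rewrite !(metric_sym p).
rewrite -ler_sqr ?nnegrE ?mdist_ge0//.
apply: le_trans (mann_fixed_decrease n Tp) _.
have /andP[a0 a1] := alpha_in n.
by rewrite gerBl mulr_ge0 ?sqr_ge0// mulr_ge0 ?subr_ge0// ltW.
Qed.

Lemma mann_bounded p : T p = p -> metric_bounded (range x).
Proof.
move=> Tp; exists (mdist p (x 0%N) + mdist p (x 0%N)).
move=> _ _ [n _ <-] [k _ <-]; apply: le_trans (metric_triangle _ p _) _.
by rewrite (metric_sym _ p) lerD//; apply: mann_fejer.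
Qed.

(* The sums and means below stop at index n included, so that the total weight
   is positive from n = 0 on. *)
Let S n := \sum_(k < n.+1) alpha k.

Let S_gt0 n : 0 < S n.
Proof.
rewrite /S big_ord_recl ltr_pwDl//; first by have /andP[] := alpha_in 0%N.
by apply: sumr_ge0 => i _; have /andP[/ltW] := alpha_in (lift ord0 i).
Qed.

Lemma partial_sums_unbounded (A : R) :
  (\sum_(0 <= n <oo) (alpha n)%:E = +oo)%E ->
  \forall n \near \oo, A <= S n.
Proof.
move=> alpha_sum; have a0 n : (0 <= (alpha n)%:E)%E.
  by rewrite lee_fin; have /andP[/ltW] := alpha_in n.
have : (fun n => \sum_(0 <= k < n) (alpha k)%:E)%E @ \oo --> +oo%E.
  by rewrite -alpha_sum; apply: is_cvg_nneseries => n *.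
rewrite -cvg_shiftS => /cvgeyPge /(_ A); apply: filterS => n /=.
by rewrite sumEFin lee_fin big_mkord.
Qed.

Let mean n y := (\sum_(k < n.+1) alpha k * mdist y (T (x k)) ^+ 2) / S n.

Lemma weighted_mean_le (f g : nat -> R) n :
  (forall k, f k <= g k) ->
  (\sum_(k < n.+1) alpha k * f k) / S n <=
  (\sum_(k < n.+1) alpha k * g k) / S n.
Proof.
move=> fg; rewrite ler_pM2r ?invr_gt0//; apply: ler_sum => k _.
by rewrite ler_wpM2l//; have /andP[/ltW] := alpha_in k.
Qed.

Lemma weighted_mean_cst c n : (\sum_(k < n.+1) alpha k * c) / S n = c.
Proof. by rewrite -mulr_suml mulrAC mulfV ?mul1r// gt_eqF// S_gt0. Qed.

Lemma mean_bounded y : metric_bounded (range x) -> bounded_nneg (mean^~ y).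
Proof.
move=> /(metric_bounded_image Tns)/(metric_bounded_dist y)[c yc].
exists (c ^+ 2) => n; rewrite /mean; apply/andP; split.
  rewrite divr_ge0 ?(ltW (S_gt0 _))// sumr_ge0// => k _.
  by rewrite mulr_ge0 ?sqr_ge0//; have /andP[/ltW] := alpha_in k.
rewrite -[leRHS](weighted_mean_cst _ n).
apply: (weighted_mean_le (f := fun k => mdist y (T (x k)) ^+ 2)
         (g := fun=> c ^+ 2)) => k.
by have /andP[? ?] := yc k; rewrite ler_sqr ?nnegrE//; lra.
Qed.

Lemma mean_midpoint y w : exists m, forall n,
  mean n m <= (mean n y + mean n w) / 2 - mdist y w ^+ 2 / 4.
Proof.
have [m mP] := CAT0_midpoint X_CAT0 y w; exists m => n.
apply: le_trans (weighted_mean_le _ (fun k => mP (T (x k)))) _.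
rewrite -[in leRHS](weighted_mean_cst (mdist y w ^+ 2 / 4) n) /mean.
rewrite -mulrDl [X in X - _]mulrAC -mulrBl ler_pM2r ?invr_gt0//.
rewrite -big_split/= mulr_suml.
by rewrite -sumrB; apply: ler_sum => k _; lra.
Qed.

(** The CAT(0) inequality bounds alpha_k d(x_k, Ty)^2 by the decrease of
    d(., Ty)^2 from x_k to x_(k+1) plus alpha_k d(T x_k, Ty)^2; insert this
    into the nonspreading inequality for y and x_k, multiplied by alpha_k. *)
Lemma mann_step_image_le y k :
  alpha k * mdist (T y) (T (x k)) ^+ 2 <=
  alpha k * mdist y (T (x k)) ^+ 2
    + (mdist (x k) (T y) ^+ 2 - mdist (x k.+1) (T y) ^+ 2).
Proof.
have /andP[a0 a1] := alpha_in k.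
have := mann_dist_sqr (T y) k.
have := Tns y (x k).
rewrite (metric_sym (T (x k)) y) (metric_sym (T (x k)) (T y)).
rewrite (metric_sym (T y) (x k)).
have e0 : 0 <= alpha k * (1 - alpha k) * mdist (x k) (T (x k)) ^+ 2.
  by rewrite mulr_ge0 ?sqr_ge0// mulr_ge0 ?subr_ge0// ltW.
rewrite -(ler_pM2l a0); lra.
Qed.

Lemma mean_image_le y n :
  mean n (T y) <= mean n y + mdist (x 0%N) (T y) ^+ 2 / S n.
Proof.
rewrite /mean -mulrDl ler_pM2r ?invr_gt0//.
apply: le_trans (ler_sum _ (fun (k : 'I_n.+1) _ => mann_step_image_le y k)) _.
rewrite big_split/= lerD2l -(big_mkord xpredT (fun k =>
  mdist (x k) (T y) ^+ 2 - mdist (x k.+1) (T y) ^+ 2)).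
under eq_bigr do rewrite -opprB.
by rewrite sumrN telescope_sumr// opprB gerBl sqr_ge0.
Qed.

Lemma bounded_mann_has_fixed_point :
  (\sum_(0 <= n <oo) (alpha n)%:E = +oo)%E -> metric_bounded (range x) ->
  exists p, T p = p.
Proof.
move=> alpha_sum xb; have mb y := mean_bounded y xb.
pose G y := rlimsup (mean^~ y).
have G0 y : 0 <= G y by exact: rlimsup_ge0.
have [|p pP] := exists_well_posed_minimizer G0.
  by apply: rlimsup_midpoint_strongly_convex => //; exact: mean_midpoint.
exists p; apply: nonspreading_fixes_minimizer (pP) => // y.
apply: rlimsup_le_eps => // e e0.
apply: filterS (partial_sums_unbounded (mdist (x 0%N) (T y) ^+ 2 / e)
  alpha_sum) => n.
rewrite ler_pdivrMr// => Sn; apply: le_trans (mean_image_le y n) _.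
by rewrite lerD2l ler_pdivrMr// mulrC.
Qed.

(** The squared distances to p decrease by at least c d(x_n, T x_n)^2 at each
    step, and convergent sequences have vanishing increments. *)
Lemma mann_almost_fixed c p : 0 < c ->
  (forall n, c <= alpha n * (1 - alpha n)) -> T p = p ->
  (fun n => mdist (x n) (T (x n))) @ \oo --> 0.
Proof.
move=> c0 ac Tp; pose D n := mdist (x n) p ^+ 2.
have decr n : c * mdist (x n) (T (x n)) ^+ 2 <= D n - D n.+1.
  have := mann_fixed_decrease n Tp; have := ac n.
  have := sqr_ge0 (mdist (x n) (T (x n))).
  rewrite -/(D n) -/(D n.+1); nra.
have Dcvg : cvgn D.
  apply: nonincreasing_is_cvgn; last by exists 0 => _ [n _ <-]; exact: sqr_ge0.
  apply/nonincreasing_seqP => n; have := decr n.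
  have : 0 <= c * mdist (x n) (T (x n)) ^+ 2 by rewrite mulr_ge0 ?sqr_ge0// ltW.
  lra.
have : (fun n => D n - D n.+1) @ \oo --> 0.
  rewrite -(subrr (limn D)); apply: cvgB => //.
  by rewrite (cvg_shiftS D (nbhs (limn D))).
move=> /cvgr0Pnorm_lt D0; apply/cvgr0Pnorm_lt => e e0.
have ce0 : 0 < c * e ^+ 2 by rewrite mulr_gt0// exprn_gt0.
move: (D0 _ ce0); apply: filterS => n; rewrite ltr_norml => /andP[_ Dn].
rewrite ger0_norm ?mdist_ge0// -ltr_sqr ?nnegrE ?mdist_ge0 ?(ltW e0)//.
by rewrite -(ltr_pM2l c0); apply: le_lt_trans (decr n) Dn.
Qed.

(** The distances from the iterates to a fixed point are nonincreasing, hence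
    convergent. *)
Lemma limsup_dist_subseq p (f : nat -> nat) : T p = p ->
  {homo f : m n / (m < n)%N} -> limsup_dist (x \o f) p = limsup_dist x p.
Proof.
move=> Tp f_incr; pose u n := (mdist p (x n))%:E.
have ucvg : u @ \oo --> ereal_inf (range u).
  by apply: ereal_nonincreasing_cvgn => m n mn; rewrite lee_fin mann_fejer.
rewrite /limsup_dist (cvg_limn_einf_sup ucvg).2.
have foo := increasing_cvg_nat f_incr.
have ufcvg : (u \o f) @ \oo --> ereal_inf (range u).
  exact: cvg_comp foo ucvg.
exact: (cvg_limn_einf_sup ufcvg).2.
Qed.

Lemma mann_Delta_convergent c p : 0 < c ->
  (forall n, c <= alpha n * (1 - alpha n)) -> T p = p ->
  exists2 q, T q = q & Delta_convergent x q.
Proof.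
move=> c0 ac Tp; have xb := mann_bounded Tp.
have x_af := mann_almost_fixed c0 ac Tp.
have [q Tq qA] := asymptotic_center_almost_fixed X_CAT0 Tns xb x_af.
exists q => // f f_incr.
have xfb : metric_bounded (range (x \o f)).
  have [M xM] := xb; exists M => _ _ [m _ <-] [n _ <-].
  by apply: xM; [exists (f m)|exists (f n)].
have foo := increasing_cvg_nat f_incr.
have [r Tr rA] := asymptotic_center_almost_fixed X_CAT0 Tns xfb
  (cvg_comp _ _ foo x_af).
(* The asymptotic center q of x is also that of x \o f: the center r of the
   latter has radius at most that of q, along x \o f and hence along x. *)
rewrite rA; suff : [set q] r by move=> ->.
rewrite -qA /asymptotic_center /=; apply/eqP; rewrite eq_le; apply/andP; split.
  have : asymptotic_center x q by rewrite qA.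
  rewrite /asymptotic_center /= => <-.
  rewrite -!(limsup_dist_subseq _ f_incr)//.
  have : asymptotic_center (x \o f) r by rewrite rA.
  rewrite /asymptotic_center /= => ->.
  by apply: ge_ereal_inf; exists (limsup_dist (x \o f) q) => //; exists q.
by apply: ge_ereal_inf; exists (limsup_dist x r) => //; exists r.
Qed.

End mann_iteration.

Theorem theorem5p3 (R : realType) (X : completeMetricType R) (T : X -> X)
    (alpha : nat -> R) (x : nat -> X)
    (X_CAT0 : CAT0 X)
    (T_nonspreading : metrically_nonspreading T)
    (alpha_in : forall n : nat, 0 < alpha n <= 1)
    (alpha_sum : (\sum_(0 <= n <oo) (alpha n)%:E = +oo)%E)
    (x_rec : forall n : nat, x n.+1 = geo_comb (alpha n) (x n) (T (x n))) :
  (fixed_points T !=set0 <-> metric_bounded (range x)) /\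
  (fixed_points T !=set0 ->
   0 < inf (range (fun n : nat => alpha n * (1 - alpha n))) ->
   exists2 p : X, fixed_points T p & Delta_convergent x p).
Proof.
split; first split=> [[p Tp]|xb].
- exact: (mann_bounded X_CAT0 T_nonspreading alpha_in x_rec Tp).
- exact: (bounded_mann_has_fixed_point X_CAT0 T_nonspreading alpha_in x_rec).
move=> [p Tp] c0.
apply: (mann_Delta_convergent X_CAT0 T_nonspreading alpha_in x_rec c0 _ Tp).
move=> n; apply: ge_inf; last by exists n.
exists 0 => _ [k _ <-]; have /andP[a0 a1] := alpha_in k.
by rewrite mulr_ge0 ?subr_ge0// ltW.
Qed.
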